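(* Let $n\ge1$ and let $\Phi=\mathrm{circ}(\varphi_0,\dots,\varphi_{n-1})\in L^\infty(\mathcal{C}_n)$. Let $U$ be the constant unitary $n\times n$ matrix with columns $v_k=\frac{1}{\sqrt n}(1,\mu_n^{k},\dots,\mu_n^{(n-1)k})^T$, $k=0,\dots,n-1$, $\mu_n=e^{2\pi i/n}$, so that $U^*\Phi U=\Lambda=\mathrm{diag}(\lambda_0,\lambda_1,\dots,\lambda_{n-1})$ with $\lambda_k=\sum_{j=0}^{n-1}\varphi_j\mu_n^{jk}$. Then the block Toeplitz operator $T_\Phi$ on $H^2(\mathbb{C}^n)$ is binormal if and only if the scalar Toeplitz operators $T_{\lambda_0},T_{\lambda_1},\dots,T_{\lambda_{n-1}}$ on $H^2$ are all binormal.
   Context: $\mathrm{circ}(a_0,\dots,a_{n-1})$ is the circulant matrix with first row $(a_0,\dots,a_{n-1})$, each subsequent row being the cyclic right shift of the previous one; $\mathcal{C}_n$ is the space of complex $n\times n$ circulant matrices and $L^\infty(\mathcal{C}_n)$ the essentially bounded measurable functions from the unit circle $\mathbb{T}$ to $\mathcal{C}_n$. $H^2(\mathbb{C}^n)$ is the $\mathbb{C}^n$-valued Hardy space on $\mathbb{T}$ ($H^2=H^2(\mathbb{C})$), $P$ the orthogonal projection of $L^2(\mathbb{T};\mathbb{C}^n)$ onto it, and $T_\Phi f=P(\Phi f)$. A bounded operator $T$ is binormal if $T^*T$ and $TT^*$ commute. *)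

(* Defs.v *)
From HB Require Import structures.
From mathcomp Require Import all_boot all_order all_algebra.
From mathcomp Require Import all_classical all_reals all_analysis.
From mathcomp Require Import measurable_realfun complex.
Set Implicit Arguments.
Unset Strict Implicit.
Unset Printing Implicit Defensive.
Import Order.TTheory GRing.Theory Num.Theory.
Import numFieldNormedType.Exports.

Local Open Scope classical_set_scope.
Local Open Scope ring_scope.
Local Open Scope complex_scope.
Local Open Scope sesquilinear_scope.

Definition expi {R : realType} (t : R) : R[i] := cos t +i* sin t.

Lemma norm_expi (R : realType) (t : R) : `|expi t| == 1.
Proof. by rewrite normc_def /= cos2Dsin2 sqrtr1. Qed.

Definition circle (R : realType) := {z : R[i] | `|z| == 1}.

HB.instance Definition _ (R : realType) := Choice.on (circle R).

Definition to_circle {R : realType} (t : R) : circle R := exist _ (expi t) (norm_expi t).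

HB.instance Definition _ (R : realType) :=
  isPointed.Build (circle R) (to_circle 0).

Definition circle_coord {R : realType} (z : circle R) : R * R :=
  (complex.Re (val z), complex.Im (val z)).

(* Borel sigma-algebra of the circle, as a subset of the plane *)
HB.instance Definition _ (R : realType) :=
  Measurable.copy (circle R) (g_sigma_algebra_preimageType (@circle_coord R)).

Lemma measurable_to_circle (R : realType) :
  measurable_fun setT (@to_circle R : measurableTypeR R -> circle R).
Proof.
move=> _ _ [B mB <-]; rewrite !setTI -comp_preimage -[X in measurable X]setTI.
have : measurable_fun setT (fun t : R => (cos t, sin t)).
  apply/measurable_fun_pairP; split.
    by apply: continuous_measurable_fun; exact: continuous_cos.
  by apply: continuous_measurable_fun; exact: continuous_sin.
by move=> /(_ measurableT _ mB).
Qed.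

HB.instance Definition _ (R : realType) := isMeasurableFun.Build _ _ _ _
  (@to_circle R : measurableTypeR R -> circle R) (@measurable_to_circle R).

Lemma twopi_gt0 (R : realType) : 0 < 2 * pi :> R.
Proof. by rewrite mulr_gt0 ?pi_gt0. Qed.

(* normalized arc length: the law of exp(it) for t uniform on [0, 2 pi] *)
Definition arclength {R : realType} : probability (circle R) R :=
  distribution (uniform_prob (twopi_gt0 R))
    (@to_circle R : {mfun measurableTypeR R >-> circle R}).

(* C^n-valued functions on the circle; identification up to null sets is kept
   explicit, through [ae_eq] below *)
Notation vfun R n := (circle R -> 'cV[R[i]]_n).
Notation mxfun R n := (circle R -> 'M[R[i]]_n).

Definition cmeasurable {R : realType} (f : circle R -> R[i]) :=
  measurable_fun setT (fun z => complex.Re (f z) : measurableTypeR R) /\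
  measurable_fun setT (fun z => complex.Im (f z) : measurableTypeR R).

Definition cintegral {R : realType} (f : circle R -> R[i]) : R[i] :=
  (\int[arclength]_(z in setT) complex.Re (f z))
    +i* (\int[arclength]_(z in setT) complex.Im (f z)).

Definition L2 {R : realType} {n : nat} (f : vfun R n) :=
  (forall i, cmeasurable (fun z => f z i 0)) /\
  (\int[arclength]_z (\sum_(i < n) complex.Re (`|f z i 0|%R ^+ 2))%:E < +oo)%E.

Definition inner {R : realType} {n : nat} (f g : vfun R n) : R[i] :=
  cintegral (fun z => \sum_(i < n) f z i 0 * (g z i 0)^*).

Definition norm2 {R : realType} {n : nat} (f : vfun R n) : R :=
  Num.sqrt (complex.Re (inner f f)).

Definition fourier {R : realType} {n : nat} (f : vfun R n) (m : int) :
    'cV[R[i]]_n :=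
  \col_i cintegral (fun z => f z i 0 * val z ^ (- m)).

Definition hardy {R : realType} {n : nat} (f : vfun R n) :=
  L2 f /\ forall m : int, m < 0 -> fourier f m = 0.

(* the default value of [xget] is never reached on L2: [hardy] is a closed
   subspace *)
Definition hardy_proj {R : realType} {n : nat} (f : vfun R n) : vfun R n :=
  xget (cst 0)
    [set g | hardy g /\ forall h, hardy h -> inner (f \- g) h = 0].

Definition Linfty {R : realType} {n : nat} (Phi : mxfun R n) :=
  (forall i j, cmeasurable (fun z => Phi z i j)) /\
  exists M : R, {ae arclength, forall z, forall i j, `|Phi z i j| <= M%:C}.

Definition toeplitz {R : realType} {n : nat} (Phi : mxfun R n) (f : vfun R n) :
    vfun R n :=
  hardy_proj (fun z => Phi z *m f z).

Definition bounded_op {R : realType} {n : nat} (T : vfun R n -> vfun R n) :=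
  [/\ forall f, hardy f -> hardy (T f),
      forall (a : R[i]) f g, hardy f -> hardy g ->
        ae_eq arclength setT (T (fun z => a *: f z + g z))
          (fun z => a *: T f z + T g z)
    & exists M : R, forall f, hardy f -> norm2 (T f) <= M * norm2 f].

(* Hilbert space adjoint of a bounded operator on the Hardy space; it is
   determined up to null sets *)
Definition adjoint {R : realType} {n : nat} (T : vfun R n -> vfun R n)
    (g : vfun R n) : vfun R n :=
  xget (cst 0)
    [set h | hardy h /\ forall f, hardy f -> inner (T f) g = inner f h].

Definition binormal {R : realType} {n : nat} (T : vfun R n -> vfun R n) :=
  bounded_op T /\
  forall f, hardy f ->
    ae_eq arclength setT (adjoint T (T (T (adjoint T f))))
      (T (adjoint T (adjoint T (T f)))).

(* [ord_pred] is the cyclic predecessor: row [i] is the first row shifted [i]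
   times to the right *)
Definition circ {A : Type} {n : nat} (a : 'I_n -> A) : 'M[A]_n :=
  \matrix_(i, j) a (iter i (@ord_pred n) j).

Definition circ_fun {R : realType} {n : nat} (phi : 'I_n -> circle R -> R[i]) :
    mxfun R n :=
  fun z => circ (fun j => phi j z).

Definition mu_root (R : realType) (n : nat) : R[i] := expi (2 * pi / n%:R).

Definition dft_mx (R : realType) (n : nat) : 'M[R[i]]_n :=
  \matrix_(i, k) ((Num.sqrt n%:R)^-1%:C * mu_root R n ^+ (i * k)).

Definition eigenfun {R : realType} {n : nat} (phi : 'I_n -> circle R -> R[i])
    (k : 'I_n) (z : circle R) : R[i] :=
  \sum_(j < n) phi j z * mu_root R n ^+ (j * k).

(* scalar Toeplitz operator, with C identified with C^1 *)
Definition scalar_toeplitz {R : realType} (lambda : circle R -> R[i]) :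
    vfun R 1 -> vfun R 1 :=
  toeplitz (fun z => (lambda z)%:M).

(* Main.v *)
Require Import Defs.
From mathcomp Require Import all_boot all_order all_algebra.
From mathcomp Require Import all_classical all_reals all_analysis.
From mathcomp Require Import measurable_realfun complex.
From mathcomp Require Import ring lra.

(** Write U for the Fourier matrix and w_k for the k-th row of U^*.  Circulant
    matrices are diagonal in the Fourier basis, so w_k Phi(z) = lambda_k(z) w_k
    and, taking adjoints, w_k Phi(z)^* = conj(lambda_k(z)) w_k.  A constant
    matrix acting on values commutes with the Hardy projection; therefore w_k,
    viewed as a map from H^2(C^n) to H^2, satisfies w_k T_Phi = T_{lambda_k} w_k
    and w_k T_Phi^* = T_{lambda_k}^* w_k ([toeplitz_intertwines]).  Hence w_k
    carries T^*TTT^* and TT^*T^*T for T = T_Phi to the corresponding words for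
    T_{lambda_k} ([intertwines_STTS]).  Since w_k w_k^* = 1, every scalar g is
    w_k (w_k^* g), and binormality descends from T_Phi to each T_{lambda_k};
    since the w_k are the rows of an invertible matrix, two vector functions
    with the same images under all of them are equal, and binormality lifts
    back.

    What remains is to know that the operators are what they should be.  The
    projection and the adjoint are choices among the functions that satisfy the
    defining conditions, so these conditions must be shown satisfiable.  For
    the projection this is the Hilbert projection theorem
    ([hardy_proj_exists]): a minimizing sequence is Cauchy by the parallelogram
    law, a fast Cauchy sequence converges almost everywhere
    ([L2_cauchy_ae_cvg]), Fatou's lemma bounds the distance to the limit
    ([L2_fatou]), and the limit stays in the Hardy space because the latter is
    the orthogonal complement of the functions z^m c with m < 0 ([hardyP]).
    The adjoint of T_Phi is then T_{Phi^*} ([toeplitz_adjoint_pair]).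

    Identities between operators hold only almost everywhere.  They are all
    derived from one principle, [hardy_weak_eq]: Hardy functions with the same
    inner products against the Hardy space agree almost everywhere. *)

Set Implicit Arguments.
Unset Strict Implicit.
Unset Printing Implicit Defensive.
Import Order.TTheory GRing.Theory Num.Theory.
Import numFieldNormedType.Exports.

Local Open Scope sesquilinear_scope.
Local Open Scope classical_set_scope.
Local Open Scope complex_scope.
Local Open Scope ring_scope.

(* The projections to R, not the ring-valued parts 'Re and 'Im. *)
Local Notation Re := complex.Re.
Local Notation Im := complex.Im.

(** * Integration of complex functions on the circle *)

Section Complex.
Variable R : realType.
Implicit Types x y : R[i].

Lemma cReD x y : Re (x + y) = Re x + Re y. Proof. by case: x => a b; case: y. Qed.
Lemma cImD x y : Im (x + y) = Im x + Im y. Proof. by case: x => a b; case: y. Qed.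
Lemma cReN x : Re (- x) = - Re x. Proof. by case: x. Qed.
Lemma cImN x : Im (- x) = - Im x. Proof. by case: x. Qed.
Lemma cReM x y : Re (x * y) = Re x * Re y - Im x * Im y.
Proof. by case: x => a b; case: y. Qed.
Lemma cImM x y : Im (x * y) = Re x * Im y + Im x * Re y.
Proof. by case: x => a b; case: y. Qed.
Lemma cReC x : Re (x^*) = Re x. Proof. by case: x. Qed.
Lemma cImC x : Im (x^*) = - Im x. Proof. by case: x. Qed.
Lemma complex_ext x y : Re x = Re y -> Im x = Im y -> x = y.
Proof. by case: x => a b; case: y => c d /= -> ->. Qed.

Lemma Re_sqr_norm x : Re (`|x| ^+ 2) = Re x ^+ 2 + Im x ^+ 2.
Proof. by rewrite -add_Re2_Im2. Qed.

Definition cint (f : circle R -> R[i]) :=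
  arclength.-integrable setT (EFin \o (fun z => Re (f z))) /\
  arclength.-integrable setT (EFin \o (fun z => Im (f z))).

Lemma cmeasurable_cst (c : R[i]) : cmeasurable (fun=> c : R[i]).
Proof. by split; exact: measurable_cst. Qed.

Lemma cmeasurableD (f g : circle R -> R[i]) :
  cmeasurable f -> cmeasurable g -> cmeasurable (fun z => f z + g z).
Proof.
move=> [f1 f2] [g1 g2]; split.
  by under eq_fun do rewrite cReD; exact: measurable_funD.
by under eq_fun do rewrite cImD; exact: measurable_funD.
Qed.

Lemma cmeasurableM (f g : circle R -> R[i]) :
  cmeasurable f -> cmeasurable g -> cmeasurable (fun z => f z * g z).
Proof.
move=> [f1 f2] [g1 g2]; split.
  under eq_fun do rewrite cReM; apply: measurable_funB; exact: measurable_funM.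
under eq_fun do rewrite cImM; apply: measurable_funD; exact: measurable_funM.
Qed.

Lemma cmeasurableC (f : circle R -> R[i]) :
  cmeasurable f -> cmeasurable (fun z => (f z)^*).
Proof.
move=> [f1 f2]; split.
  by under eq_fun do rewrite cReC.
under eq_fun do rewrite cImC; exact: measurable_funN.
Qed.

Lemma cmeasurable_sum (I : Type) (s : seq I) (F : I -> circle R -> R[i]) :
  (forall i, cmeasurable (F i)) -> cmeasurable (fun z => \sum_(i <- s) F i z).
Proof.
move=> mF; elim: s => [|i s IH].
  by under eq_fun do rewrite big_nil; exact: cmeasurable_cst.
by under eq_fun do rewrite big_cons; exact: cmeasurableD.
Qed.

(** On the unit circle conjugation is inversion. *)
Lemma conj_coordX (z : circle R) (m : int) : (val z ^ m)^* = val z ^ (- m).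
Proof.
have /eqP z1 := valP z.
have z0 : val z != 0 by rewrite -normr_gt0 z1.
have zV : (val z)^* = (val z)^-1 by rewrite invC_norm z1 expr1n invr1 mul1r.
by rewrite (fmorphXz Num.conj) /= zV exprz_inv.
Qed.

Lemma normX_coord (z : circle R) (m : int) : `|val z ^ m| = 1.
Proof.
have /eqP z1 := valP z.
by case: m => k; rewrite /exprz ?normfV normrX z1 expr1n ?invr1.
Qed.

Lemma cmeasurable_coordX (m : int) :
  cmeasurable (fun z : circle R => val z ^ m).
Proof.
have mv : cmeasurable (fun z : circle R => val z).
  have : measurable_fun setT (@circle_coord R).
    by move=> _ B mB; rewrite setTI; exists B => //; rewrite setTI.
  by move=> /measurable_fun_pairP[].
have mX (k : nat) : cmeasurable (fun z : circle R => val z ^+ k).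
  elim: k => [|k IH]; first exact: cmeasurable_cst.
  by under eq_fun do rewrite exprS; exact: cmeasurableM.
case: m => k; first exact: mX.
rewrite NegzE; under eq_fun do rewrite -conj_coordX.
exact/cmeasurableC/mX.
Qed.

Lemma cintD f g : cint f -> cint g -> cint (fun z => f z + g z).
Proof.
move=> [f1 f2] [g1 g2]; split.
  rewrite (_ : _ \o _ = ((EFin \o (fun z => Re (f z))) \+
                         (EFin \o (fun z => Re (g z))))%E).
    exact: integrableD.
  by apply/funext => z /=; rewrite cReD.
rewrite (_ : _ \o _ = ((EFin \o (fun z => Im (f z))) \+
                       (EFin \o (fun z => Im (g z))))%E).
  exact: integrableD.
by apply/funext => z /=; rewrite cImD.
Qed.

Lemma cintegralD f g : cint f -> cint g ->
  cintegral (fun z => f z + g z) = cintegral f + cintegral g.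
Proof.
move=> [f1 f2] [g1 g2]; rewrite /cintegral.
by under eq_Rintegral do rewrite cReD; rewrite RintegralD//;
  under [X in _ +i* X]eq_Rintegral do rewrite cImD; rewrite RintegralD.
Qed.

Lemma rintZ (a : R) (f : circle R -> R) :
  arclength.-integrable setT (EFin \o f) ->
  arclength.-integrable setT (EFin \o (fun z => a * f z)).
Proof.
move=> fi; rewrite (_ : _ \o _ = (fun z => a%:E * (EFin \o f) z)%E).
  exact: integrableZl.
by apply/funext => z /=; rewrite EFinM.
Qed.

Lemma cintZ a f : cint f -> cint (fun z => a * f z).
Proof.
move=> [f1 f2]; split.
  rewrite (_ : _ \o _ = ((EFin \o (fun z => Re a * Re (f z))%R) \+
                         (EFin \o (fun z => (- Im a) * Im (f z))%R))%E).
    by apply: integrableD => //; exact: rintZ.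
  by apply/funext => z /=; rewrite cReM mulNr.
rewrite (_ : _ \o _ = ((EFin \o (fun z => Re a * Im (f z))%R) \+
                       (EFin \o (fun z => Im a * Re (f z))%R))%E).
  by apply: integrableD => //; exact: rintZ.
by apply/funext => z /=; rewrite cImM.
Qed.

Lemma cintegralZ a f : cint f ->
  cintegral (fun z => a * f z) = a * cintegral f.
Proof.
move=> [f1 f2]; rewrite /cintegral; apply: complex_ext; rewrite ?cReM ?cImM /=.
  under eq_Rintegral do rewrite cReM.
  by rewrite RintegralB ?RintegralZl//; exact: rintZ.
under eq_Rintegral do rewrite cImM.
by rewrite RintegralD ?RintegralZl//; exact: rintZ.
Qed.

Lemma cintegralC f : cint f ->
  cintegral (fun z => (f z)^*) = ((cintegral f)^*).
Proof.
move=> [f1 f2]; rewrite /cintegral; apply: complex_ext.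
  by rewrite cReC/=; under eq_Rintegral do rewrite cReC.
rewrite cImC/=; under eq_Rintegral do rewrite cImC -mulN1r.
by rewrite RintegralZl// mulN1r.
Qed.

Lemma cint_sum (I : Type) (s : seq I) (F : I -> circle R -> R[i]) :
  (forall i, cint (F i)) -> cint (fun z => \sum_(i <- s) F i z).
Proof.
move=> mF; elim: s => [|i s IH].
  under eq_fun do rewrite big_nil.
  by split; rewrite (_ : _ \o _ = cst 0%E)//; exact: integrable0.
by under eq_fun do rewrite big_cons; exact: cintD.
Qed.

Lemma cintegral_sum (I : Type) (s : seq I) (F : I -> circle R -> R[i]) :
  (forall i, cint (F i)) ->
  cintegral (fun z => \sum_(i <- s) F i z) = \sum_(i <- s) cintegral (F i).
Proof.
move=> mF; elim: s => [|i s IH].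
  rewrite big_nil; under eq_fun do rewrite big_nil.
  by rewrite /cintegral Rintegral_cst// mul0r.
rewrite big_cons -IH -cintegralD//; last exact: cint_sum.
by under eq_fun do rewrite big_cons.
Qed.

End Complex.

(** * The pointwise inner product of C^n *)

(* Otherwise simplification expands a squared modulus into square roots. *)
#[local] Arguments complex.Re : simpl never.
#[local] Arguments complex.Im : simpl never.

Section Pointwise.
Variable R : realType.

Definition dot n (u v : 'cV[R[i]]_n) : R[i] :=
  \sum_(i < n) u i 0 * (v i 0)^*.

Definition nsq n (u : 'cV[R[i]]_n) : R := \sum_(i < n) Re (`|u i 0| ^+ 2).

Lemma dotDl n (u v w : 'cV_n) : dot (u + v) w = dot u w + dot v w.
Proof.
by rewrite /dot -big_split/=; apply: eq_bigr => i _; rewrite mxE mulrDl.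
Qed.

Lemma dotZl n a (u w : 'cV_n) : dot (a *: u) w = a * dot u w.
Proof.
by rewrite /dot mulr_sumr; apply: eq_bigr => i _; rewrite mxE mulrA.
Qed.

Lemma dotC n (u v : 'cV_n) : dot v u = (dot u v)^*.
Proof.
rewrite /dot rmorph_sum; apply: eq_bigr => i _.
by rewrite rmorphM/= conjCK mulrC.
Qed.

Lemma dotE n (u v : 'cV_n) : dot u v = (v^t* *m u) 0 0.
Proof. by rewrite mxE; apply: eq_bigr => i _; rewrite !mxE mulrC. Qed.

Lemma dot_adj m n (A : 'M[R[i]]_(m, n)) (u : 'cV_n) (v : 'cV_m) :
  dot (A *m u) v = dot u (A^t* *m v).
Proof. by rewrite !dotE trmx_mul map_mxM /= trmxCK mulmxA. Qed.

Lemma nsq_ge0 n (u : 'cV_n) : 0 <= nsq u.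
Proof.
by apply: sumr_ge0 => i _; rewrite Re_sqr_norm addr_ge0// sqr_ge0.
Qed.

Lemma dot_nsq n (u : 'cV_n) : dot u u = (nsq u)%:C.
Proof.
rewrite /dot /nsq rmorph_sum; apply: eq_bigr => i _.
by rewrite -normCK -add_Re2_Im2.
Qed.

Lemma nsq_coord n (u : 'cV_n) i : Re (`|u i 0| ^+ 2) <= nsq u.
Proof.
rewrite /nsq (bigD1 i)// lerDl; apply: sumr_ge0 => j _.
by rewrite Re_sqr_norm addr_ge0// sqr_ge0.
Qed.

Lemma nsq_eq0 n (u : 'cV_n) : nsq u = 0 -> u = 0.
Proof.
move=> u0; apply/matrixP => i j; rewrite ord1 mxE.
have := nsq_coord u i; rewrite u0 Re_sqr_norm => h.
have := sqr_ge0 (Re (u i 0)); have := sqr_ge0 (Im (u i 0)) => h1 h2.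
by apply: complex_ext; apply/eqP; rewrite -sqrf_eq0; apply/eqP => /=; lra.
Qed.

Lemma nsq0 n : nsq (0 : 'cV_n) = 0.
Proof. by rewrite /nsq big1// => i _; rewrite mxE normr0 expr0n. Qed.

Lemma nsqD_le n (u v : 'cV_n) : nsq (u + v) <= 2 * (nsq u + nsq v).
Proof.
rewrite /nsq -big_split/= mulr_sumr; apply: ler_sum => i _.
rewrite !Re_sqr_norm mxE cReD cImD.
have := sqr_ge0 (Re (u i 0) - Re (v i 0)).
have := sqr_ge0 (Im (u i 0) - Im (v i 0)). nra.
Qed.

Lemma nsqZ n a (u : 'cV_n) : nsq (a *: u) = Re (`|a| ^+ 2) * nsq u.
Proof.
rewrite /nsq mulr_sumr; apply: eq_bigr => i _.
by rewrite !Re_sqr_norm mxE cReM cImM; ring.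
Qed.

(** A crude substitute for the Cauchy-Schwarz inequality: it is enough to make
    products of square-integrable functions integrable. *)
Lemma Re_dot_le n (u v : 'cV_n) : `|Re (dot u v)| <= nsq u + nsq v.
Proof.
rewrite /dot /nsq -big_split/= raddf_sum/=.
apply: (le_trans (ler_norm_sum _ _ _)); apply: ler_sum => i _.
rewrite !Re_sqr_norm cReM cReC cImC ler_norml.
move: (u i 0) (v i 0) => [a b] [c d]; rewrite /complex.Re /complex.Im.
have := sqr_ge0 (a + c); have := sqr_ge0 (a - c).
have := sqr_ge0 (b + d); have := sqr_ge0 (b - d).
have := sqr_ge0 a; have := sqr_ge0 c.
have := sqr_ge0 b; have := sqr_ge0 d.
by move=> *; apply/andP; split; nra.
Qed.

Lemma Im_dot_le n (u v : 'cV_n) : `|Im (dot u v)| <= nsq u + nsq v.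
Proof.
rewrite /dot /nsq -big_split/= raddf_sum/=.
apply: (le_trans (ler_norm_sum _ _ _)); apply: ler_sum => i _.
rewrite !Re_sqr_norm cImM cReC cImC ler_norml.
move: (u i 0) (v i 0) => [a b] [c d]; rewrite /complex.Re /complex.Im.
have := sqr_ge0 (a + d); have := sqr_ge0 (a - d).
have := sqr_ge0 (b + c); have := sqr_ge0 (b - c).
have := sqr_ge0 a; have := sqr_ge0 d.
have := sqr_ge0 b; have := sqr_ge0 c.
by move=> *; apply/andP; split; nra.
Qed.

End Pointwise.

(** * Square-integrable vector functions *)

Section SquareIntegrable.
Variables (R : realType) (n : nat).
Implicit Types f g h : vfun R n.
Notation mu := (@arclength R).

Definition vmeasurable f := forall i, cmeasurable (fun z => f z i 0).

(** The squared norm, as a real number; [norm2] is its square root. *)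
Definition sqnorm f : R := \int[mu]_(z in setT) nsq (f z).

Lemma measurable_nsq f : vmeasurable f ->
  measurable_fun setT (fun z => nsq (f z)).
Proof.
move=> mf; apply: measurable_sum => i.
under eq_fun do rewrite Re_sqr_norm.
have [m1 m2] := mf i.
by apply: measurable_funD; apply: measurable_funX.
Qed.

Lemma vmeasurableD f g : vmeasurable f -> vmeasurable g -> vmeasurable (f + g).
Proof.
by move=> mf mg i; under eq_fun do rewrite mxE; exact: cmeasurableD.
Qed.

Lemma vmeasurableZ a f : vmeasurable f -> vmeasurable (a *: f).
Proof.
move=> mf i; under eq_fun do rewrite mxE.
by apply: cmeasurableM => //; exact: cmeasurable_cst.
Qed.

Lemma cmeasurable_dot f g : vmeasurable f -> vmeasurable g ->
  cmeasurable (fun z => dot (f z) (g z)).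
Proof.
by move=> mf mg; apply: cmeasurable_sum => i; apply: cmeasurableM => //;
  exact: cmeasurableC.
Qed.

Lemma L2_measurable f : L2 f -> vmeasurable f. Proof. by case. Qed.

Lemma L2_integrable f : L2 f -> mu.-integrable setT (EFin \o (fun z => nsq (f z))).
Proof.
move=> [mf fi]; apply/integrableP; split.
  by apply/measurable_EFinP; exact: measurable_nsq.
under eq_integral do rewrite /= ger0_norm ?nsq_ge0//.
exact: fi.
Qed.

(** The domination only has to hold almost everywhere, as is the case for the
    bound on an essentially bounded symbol. *)
Lemma L2_dom f (b : circle R -> R) : vmeasurable f ->
  mu.-integrable setT (EFin \o b) ->
  {ae mu, forall z, nsq (f z) <= b z} -> L2 f.
Proof.
move=> mf bi fb; split=> //.
have [mb] := integrableP _ _ _ bi; apply: le_lt_trans.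
apply: ae_ge0_le_integral => //.
- by move=> z _; rewrite lee_fin nsq_ge0.
- by apply/measurable_EFinP; exact: measurable_nsq.
- exact: measurableT_comp.
- apply: filterS fb => z fbz _.
  by rewrite lee_fin (le_trans fbz)// ler_norm.
Qed.

Lemma L2_0 : L2 (0 : vfun R n).
Proof.
apply: (@L2_dom _ (cst 0)).
- by move=> i; under eq_fun do rewrite mxE; exact: cmeasurable_cst.
- by rewrite (_ : _ \o _ = cst 0%E)//; exact: integrable0.
- by apply: aeW => z; rewrite nsq0.
Qed.

Lemma L2D f g : L2 f -> L2 g -> L2 (f + g).
Proof.
move=> Lf Lg; apply: (@L2_dom _ (fun z => 2 * (nsq (f z) + nsq (g z)))).
- by apply: vmeasurableD; exact: L2_measurable.
- apply: rintZ; rewrite (_ : _ \o _ = ((EFin \o (fun z => nsq (f z))) \+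
    (EFin \o (fun z => nsq (g z))))%E)//.
  by apply: integrableD => //; exact: L2_integrable.
- by apply: aeW => z; exact: nsqD_le.
Qed.

Lemma L2Z a f : L2 f -> L2 (a *: f).
Proof.
move=> Lf; apply: (@L2_dom _ (fun z => Re (`|a| ^+ 2) * nsq (f z))).
- by apply: vmeasurableZ; exact: L2_measurable.
- by apply: rintZ; exact: L2_integrable.
- by apply: aeW => z; rewrite nsqZ.
Qed.

Lemma L2N f : L2 f -> L2 (- f).
Proof. by rewrite -scaleN1r; exact: L2Z. Qed.

Lemma L2B f g : L2 f -> L2 g -> L2 (f - g).
Proof. by move=> ? ?; apply: L2D => //; exact: L2N. Qed.

Lemma cint_dot f g : L2 f -> L2 g -> cint (fun z => dot (f z) (g z)).
Proof.
move=> Lf Lg; have [m1 m2] := cmeasurable_dot (L2_measurable Lf) (L2_measurable Lg).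
have I : mu.-integrable setT (EFin \o (fun z => nsq (f z) + nsq (g z))).
  rewrite (_ : _ \o _ = ((EFin \o (fun z => nsq (f z))) \+
    (EFin \o (fun z => nsq (g z))))%E)//.
  by apply: integrableD => //; exact: L2_integrable.
split; apply: (le_integrable _ _ _ I) => //; try exact/measurable_EFinP;
  move=> z _; rewrite lee_fin [leRHS]ger0_norm ?addr_ge0 ?nsq_ge0//.
  exact: Re_dot_le.
exact: Im_dot_le.
Qed.

Lemma innerDl f g h : L2 f -> L2 g -> L2 h ->
  inner (f + g) h = inner f h + inner g h.
Proof.
move=> Lf Lg Lh; rewrite -[LHS]/(cintegral (fun z => dot (f z + g z) (h z))).
under eq_fun do rewrite dotDl.
by rewrite cintegralD//; exact: cint_dot.
Qed.

Lemma innerZl a f h : L2 f -> L2 h -> inner (a *: f) h = a * inner f h.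
Proof.
move=> Lf Lh; rewrite -[LHS]/(cintegral (fun z => dot (a *: f z) (h z))).
under eq_fun do rewrite dotZl.
by rewrite cintegralZ//; exact: cint_dot.
Qed.

Lemma innerC f g : L2 f -> L2 g -> inner g f = (inner f g)^*.
Proof.
move=> Lf Lg; rewrite -[LHS]/(cintegral (fun z => dot (g z) (f z))).
under eq_fun do rewrite dotC.
by rewrite cintegralC//; exact: cint_dot.
Qed.

(** The integrand on the left is real at every point. *)
Lemma inner_sqnorm f : inner f f = (sqnorm f)%:C.
Proof.
rewrite -[LHS]/(cintegral (fun z => dot (f z) (f z))).
under eq_fun do rewrite dot_nsq.
by rewrite /cintegral [in X in _ +i* X]/complex.Im Rintegral_cst// mul0r.
Qed.

Lemma sqnorm_ge0 f : 0 <= sqnorm f.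
Proof. by apply: Rintegral_ge0 => z _; exact: nsq_ge0. Qed.

Lemma sqnormE f : L2 f -> (sqnorm f)%:E = (\int[mu]_z (nsq (f z))%:E)%E.
Proof.
by move=> Lf; rewrite /sqnorm /Rintegral fineK//; apply: integrable_fin_num => //;
  exact: L2_integrable.
Qed.

(** Almost everywhere equality thus becomes a statement about the seminorm, open
    to inner product algebra. *)
Lemma sqnorm_eq0 f : L2 f -> sqnorm f = 0 <-> ae_eq mu setT f (0 : vfun R n).
Proof.
move=> Lf; have mf : measurable_fun setT (fun z => (nsq (f z))%:E).
  by apply/measurable_EFinP/measurable_nsq/L2_measurable.
have nn : (\int[mu]_z `|(nsq (f z))%:E| = (sqnorm f)%:E)%E.
  by rewrite sqnormE//; apply: eq_integral => z _; rewrite /= ger0_norm ?nsq_ge0.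
split=> [qf0|f0].
  have : ae_eq mu setT (fun z => (nsq (f z))%:E) (cst 0%E).
    by apply/ae_eq_integral_abs => //; rewrite nn qf0.
  by apply: filterS => z /(_ I)[] /nsq_eq0.
apply: EFin_inj; rewrite -nn.
by apply/ae_eq_integral_abs => //; apply: filterS f0 => z /(_ I) -> _; rewrite nsq0.
Qed.

End SquareIntegrable.

(** * Inner product geometry up to null sets *)

Section InnerProduct.
Variables (R : realType) (n : nat).
Implicit Types f g h : vfun R n.

Lemma innerDr f g h : L2 f -> L2 g -> L2 h ->
  inner h (f + g) = inner h f + inner h g.
Proof.
move=> Lf Lg Lh; rewrite innerC//; last exact: L2D.
by rewrite innerDl// rmorphD/= -!innerC.
Qed.

Lemma innerZr a f h : L2 f -> L2 h -> inner h (a *: f) = a^* * inner h f.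
Proof.
move=> Lf Lh; rewrite innerC//; last exact: L2Z.
by rewrite innerZl// rmorphM/= -innerC.
Qed.

Lemma innerBl f g h : L2 f -> L2 g -> L2 h ->
  inner (f - g) h = inner f h - inner g h.
Proof.
move=> Lf Lg Lh; rewrite innerDl//; last exact: L2N.
by rewrite -scaleN1r innerZl// mulN1r.
Qed.

Lemma innerBr f g h : L2 f -> L2 g -> L2 h ->
  inner h (f - g) = inner h f - inner h g.
Proof.
move=> Lf Lg Lh; rewrite innerC//; last exact: L2B.
by rewrite innerBl// rmorphB/= -!innerC.
Qed.

Lemma parallelogram f g : L2 f -> L2 g ->
  sqnorm (f + g) + sqnorm (f - g) = 2 * sqnorm f + 2 * sqnorm g.
Proof.
move=> Lf Lg; apply: (@complexI R); rewrite !(rmorphD, rmorphM) /= -!inner_sqnorm.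
have LD := L2D Lf Lg; have LB := L2B Lf Lg.
rewrite (innerDl Lf Lg LD) (innerBl Lf Lg LB).
rewrite !(innerDr Lf Lg)// !(innerBr Lf Lg)// rmorph1; ring.
Qed.

Lemma sqnormZ a f : L2 f -> sqnorm (a *: f) = Re (`|a| ^+ 2) * sqnorm f.
Proof.
move=> Lf; apply: (@complexI R); rewrite rmorphM /= -!inner_sqnorm.
have La := L2Z a Lf.
by rewrite innerZl// innerZr// Re_sqr_norm add_Re2_Im2 normCK mulrA.
Qed.

Lemma sqnormBC f g : L2 f -> L2 g -> sqnorm (f - g) = sqnorm (g - f).
Proof.
move=> Lf Lg; rewrite -opprB -scaleN1r sqnormZ; last exact: L2B.
by rewrite normrN normr1 expr1n mul1r.
Qed.

(** The squared distance from [f] to points of the line spanned by [g], in the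
    direction where the cross term is real and has a definite sign. *)
Lemma sqnorm_sub_proj f g (t : R) : L2 f -> L2 g ->
  sqnorm (f - (t%:C * inner f g) *: g) =
  sqnorm f - 2 * t * Re (`|inner f g| ^+ 2) +
  t ^+ 2 * Re (`|inner f g| ^+ 2) * sqnorm g.
Proof.
move=> Lf Lg; apply: (@complexI R).
have La := L2Z (t%:C * inner f g) Lg.
have LB := L2B Lf La.
have : (Re (`|inner f g| ^+ 2))%:C = inner f g * (inner f g)^*.
  by rewrite Re_sqr_norm add_Re2_Im2 normCK.
move: (Re _) => B hB.
rewrite !(rmorphD, rmorphN, rmorphM, rmorphXn) /= -!inner_sqnorm hB.
rewrite (innerBl Lf La LB) !(innerBr Lf La)// !innerZl// !innerZr// (innerC Lf Lg).
have -> : (t%:C * inner f g)^* = t%:C * (inner f g)^*.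
  by rewrite rmorphM/= conj_Creal//; apply/complex_realP; exists t.
rewrite rmorph1/=; ring.
Qed.

(** The discriminant argument, in the shape given by [sqnorm_sub_proj], where the
    linear coefficient reappears in the quadratic one.  It yields both the
    Cauchy-Schwarz inequality and, for [A = 0], the orthogonality of a minimizer. *)
Lemma quadratic_bound (A B C : R) : 0 <= A -> 0 <= B -> 0 <= C ->
  (forall t, 0 <= A - 2 * t * B + t ^+ 2 * B * C) -> B <= A * C.
Proof.
move=> A0 B0; rewrite le_eqVlt => /orP[/eqP <-|C0] H.
  rewrite mulr0 leNgt; apply/negP => Bgt0.
  (* For C = 0 the expression is affine in t, and this t makes it -1. *)
  have := H ((A + 1) / (2 * B)).
  have -> : 2 * ((A + 1) / (2 * B)) * B = A + 1 by field; rewrite gt_eqF.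
  by rewrite mulr0 addr0; lra.
have := H C^-1.
have -> : C^-1 ^+ 2 * B * C = C^-1 * B by field; rewrite gt_eqF.
move=> h; have : C^-1 * B <= A by lra.
by rewrite ler_pdivrMl// mulrC.
Qed.

Lemma Re_sqr_ge0 (x : R[i]) : 0 <= Re (`|x| ^+ 2).
Proof. by rewrite Re_sqr_norm addr_ge0// sqr_ge0. Qed.

Lemma Re_sqr_eq0 (x : R[i]) : Re (`|x| ^+ 2) <= 0 -> x = 0.
Proof.
rewrite Re_sqr_norm => h.
have := sqr_ge0 (Re x); have := sqr_ge0 (Im x) => h1 h2.
by apply: complex_ext; apply/eqP; rewrite -sqrf_eq0; apply/eqP => /=; lra.
Qed.

Lemma cauchy_schwarz f g : L2 f -> L2 g ->
  Re (`|inner f g| ^+ 2) <= sqnorm f * sqnorm g.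
Proof.
move=> Lf Lg; apply: quadratic_bound; rewrite ?sqnorm_ge0 ?Re_sqr_ge0// => t.
by rewrite -sqnorm_sub_proj// sqnorm_ge0.
Qed.

(** The variational characterization of orthogonality: if moving along [g] never
    decreases the norm, the first-order term vanishes. *)
Lemma orthogonal_of_min f g : L2 f -> L2 g ->
  (forall a, sqnorm f <= sqnorm (f - a *: g)) -> inner f g = 0.
Proof.
move=> Lf Lg fmin; apply: Re_sqr_eq0; rewrite -(mul0r (sqnorm g)).
apply: quadratic_bound; rewrite ?sqnorm_ge0 ?Re_sqr_ge0// => t.
by have := fmin (t%:C * inner f g); rewrite sqnorm_sub_proj//; lra.
Qed.

Lemma sqnorm_sub_eq0 f g : L2 f -> L2 g ->
  sqnorm (f - g) = 0 <-> ae_eq arclength setT f g.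
Proof.
move=> Lf Lg; rewrite sqnorm_eq0; last exact: L2B.
split; apply: filterS => z /(_ I) h _.
  by apply/subr0_eq; exact: h.
by rewrite /= -[(f - g) z]/(f z - g z) h subrr.
Qed.

Lemma inner_ae_eql f g h : L2 f -> L2 g -> L2 h ->
  ae_eq arclength setT f g -> inner f h = inner g h.
Proof.
move=> Lf Lg Lh /(sqnorm_sub_eq0 Lf Lg) fg; have LB := L2B Lf Lg.
apply/subr0_eq; rewrite -innerBl//; apply: Re_sqr_eq0.
by apply: (le_trans (cauchy_schwarz LB Lh)); rewrite fg mul0r.
Qed.

End InnerProduct.

(** * Completeness *)

Section Completeness.
Variable R : realType.

(** The integral of the sum of the increments is finite, so almost everywhere the
    increments are absolutely summable and the sequence converges.  The limit
    superior serves as limit because it is measurable even at the points of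
    divergence. *)
Lemma ae_cvg_of_summable d (T : measurableType d) (mu : {measure set T -> \bar R})
    (u : nat -> T -> R) :
  (forall k, measurable_fun setT (u k)) ->
  (\sum_(0 <= k <oo) \int[mu]_z (`|u k.+1 z - u k z|)%:E < +oo)%E ->
  exists2 v : T -> R, measurable_fun setT v &
    {ae mu, forall z, u ^~ z @ \oo --> v z}.
Proof.
move=> mu_k us.
have md k : measurable_fun setT (fun z => (`|u k.+1 z - u k z|)%:E).
  apply/measurable_EFinP; apply: measurableT_comp => //.
  exact: measurable_funB.
have mG : measurable_fun setT
    (fun z => \sum_(0 <= k <oo) (`|u k.+1 z - u k z|)%:E)%E.
  by apply: ge0_emeasurable_sum => // k z _ _; rewrite lee_fin.
have iG : mu.-integrable setT
    (fun z => \sum_(0 <= k <oo) (`|u k.+1 z - u k z|)%:E)%E.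
  apply/integrableP; split=> //.
  under eq_integral.
    move=> z _; rewrite gee0_abs; last by apply: nneseries_ge0.
    over.
  by rewrite integral_nneseries// => k z _; rewrite lee_fin.
exists (fun z => fine (limn_esup (fun k => (u k z)%:E))).
  apply: measurableT_comp; first exact: fine_measurable.
  by apply: measurable_fun_limn_esup => k; exact/measurable_EFinP.
apply: filterS (integrable_ae measurableT iG) => z /(_ I) Gz.
have cu : cvgn (u ^~ z).
  have : cvgn (series (telescope (u ^~ z))).
    apply: normed_cvg; apply: nnseries_is_cvg => [k|]; first exact: normr_ge0.
    by rewrite ltey_eq Gz.
  rewrite telescopeK => cs.
  have -> : (u ^~ z) = (fun k => (u k z - u 0%N z) + u 0%N z).
    by apply/funext => k; rewrite subrK.
  by apply: is_cvgD => //; exact: is_cvg_cst.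
have cE : (fun k => (u k z)%:E) @ \oo --> (limn (u ^~ z))%:E.
  by apply: cvg_EFin => //; exact: nearW.
by rewrite (cvg_limn_einf_sup cE).2.
Qed.

(** On a probability space a geometric L^2 bound on the increments gives a
    geometric L^1 bound, by |x| <= 2^k x^2 + 2^-k. *)
Lemma ae_cvg_of_geometric d (T : measurableType d) (mu : probability T R)
    (u : nat -> T -> R) (C : R) :
  (forall k, measurable_fun setT (u k)) ->
  (forall k, \int[mu]_z ((u k.+1 z - u k z) ^+ 2)%:E <= (C * (4 ^- k))%:E)%E ->
  exists2 v : T -> R, measurable_fun setT v &
    {ae mu, forall z, u ^~ z @ \oo --> v z}.
Proof.
move=> mu_k uC; apply: ae_cvg_of_summable => //.
have md k : measurable_fun setT (fun z => u k.+1 z - u k z).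
  exact: measurable_funB.
apply: (@le_lt_trans _ _ (\sum_(0 <= k <oo) ((C + 1) * 2 ^- k)%:E)%E).
  apply: lee_nneseries => [k _ _|k _].
    by apply: integral_ge0 => z _; rewrite lee_fin.
  apply: (@le_trans _ _ (\int[mu]_z
     (((2 ^+ k)%:E * ((u k.+1 z - u k z) ^+ 2)%:E) + (2 ^- k)%:E))%E).
    apply: ge0_le_integral => //.
    - by apply/measurable_EFinP; apply: measurableT_comp.
    - apply/measurable_EFinP; apply: measurable_funD => //.
      by apply: measurable_funM => //; exact: measurable_funX.
    - move=> z _; rewrite -EFinM -EFinD lee_fin.
      move: (u k.+1 z - u k z) => x.
      rewrite -[x ^+ 2]real_normK ?num_real//; move: `|x| => {}x.
      have p0 : 0 < (2 : R) ^+ k by rewrite exprn_gt0.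
      rewrite -(ler_pM2l p0) mulrDr divff ?gt_eqF//.
      have -> : 2 ^+ k * (2 ^+ k * x ^+ 2) = (2 ^+ k * x) ^+ 2 :> R by ring.
      by have := sqr_ge0 (2 ^+ k * x - 1); have := sqr_ge0 (2 ^+ k * x + 1); nra.
  rewrite ge0_integralD//=; last 2 first.
  - by move=> z _; rewrite -EFinM lee_fin mulr_ge0 ?sqr_ge0 ?exprn_ge0.
  - apply/measurable_EFinP; apply: measurable_funM => //; exact: measurable_funX.
  rewrite ge0_integralZl//=; last 2 first.
  - by apply/measurable_EFinP; exact: measurable_funX.
  - by move=> z _; rewrite lee_fin sqr_ge0.
  rewrite integral_cst//= probability_setT mule1 mulrDl mul1r EFinD leeD2r//.
  have -> : C / 2 ^+ k = 2 ^+ k * (C * 4 ^- k).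
    have -> : (4 : R) = 2 * 2 by ring.
    rewrite exprMn; field.
    by rewrite gt_eqF// exprn_gt0.
  by rewrite EFinM; apply: lee_wpmul2l; rewrite ?lee_fin ?exprn_ge0.
(* This sums r / 2^(k + 1) over k, whence the factor 2 in r. *)
have := @cvg_geometric_eseries_half R (2 * (C + 1)) 0.
rewrite expr0 divr1 => /cvg_lim; rewrite /eseries => h.
rewrite [ltLHS](_ : _ = (2 * (C + 1))%:E) ?ltry// -h//.
congr (limn _); apply/funext => m; apply: eq_bigr => k _; congr EFin.
rewrite addn1 natrX exprS; field.
by rewrite gt_eqF// exprn_gt0.
Qed.

(** Fatou's lemma for a sequence that converges only almost everywhere and whose
    integrals share a bound. *)
Lemma fatou_ae_bound d (T : measurableType d) (mu : {measure set T -> \bar R})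
    (f : nat -> T -> R) (g : T -> R) (c : \bar R) :
  (forall k, measurable_fun setT (f k)) -> (forall k z, 0 <= f k z) ->
  measurable_fun setT g -> (forall z, 0 <= g z) ->
  {ae mu, forall z, f ^~ z @ \oo --> g z} ->
  (forall k, \int[mu]_z (f k z)%:E <= c)%E -> (\int[mu]_z (g z)%:E <= c)%E.
Proof.
move=> mf f0 mg g0 fg fc.
have mF k : measurable_fun setT (fun z => (f k z)%:E) by exact/measurable_EFinP.
apply: (@le_trans _ _ (\int[mu]_z limn_einf (fun k => (f k z)%:E))%E).
  apply: ae_ge0_le_integral => //.
  - by move=> z _; rewrite lee_fin.
  - exact/measurable_EFinP.
  - move=> z _; rewrite limn_einf_lim; apply: lime_ge; first exact: is_cvg_einfs.
    by apply: nearW => k; apply/ereal_infP => _ [j _ <-]; rewrite lee_fin.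
  - under eq_fun do rewrite -[limn_einf _]oppeK -limn_esupN.
    apply: measurableT_comp; first exact: oppe_measurable.
    apply: measurable_fun_limn_esup => k.
    by apply: measurableT_comp => //; exact: oppe_measurable.
  apply: filterS fg => z fgz _.
  have cE : (fun k => (f k z)%:E) @ \oo --> (g z)%:E.
    by apply: cvg_EFin => //; exact: nearW.
  by rewrite (cvg_limn_einf_sup cE).1.
apply: (le_trans (fatou _ _ _ _)) => //.
  by move=> k z _; rewrite lee_fin.
rewrite limn_einf_lim; apply: lime_le; first exact: is_cvg_einfs.
apply: nearW => k; apply: le_trans (fc k).
by apply: ereal_inf_lbound; exists k => /=.
Qed.

(** Convergence of vectors is spelled out on real and imaginary parts of the
    entries, which is where measurability and integrals live. *)
Definition cvg_coord n (f : nat -> 'cV[R[i]]_n) (g : 'cV[R[i]]_n) := forall i,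
  (fun k => Re (f k i 0)) @ \oo --> Re (g i 0) /\
  (fun k => Im (f k i 0)) @ \oo --> Im (g i 0).

Lemma cvg_nsq n (f : nat -> 'cV[R[i]]_n) g :
  cvg_coord f g -> (fun k => nsq (f k)) @ \oo --> nsq g.
Proof.
move=> fg; rewrite /nsq; apply: cvg_big => [|i _].
  by apply: add_continuous.
under eq_fun do rewrite Re_sqr_norm; rewrite Re_sqr_norm.
have [f1 f2] := fg i.
by apply: cvgD; [exact: (cvgM f1 f1)|exact: (cvgM f2 f2)].
Qed.

Lemma cvg_coordBl n (f : nat -> 'cV[R[i]]_n) g c :
  cvg_coord f g -> cvg_coord (fun k => c - f k) (c - g).
Proof.
move=> fg i; have [f1 f2] := fg i; rewrite !mxE.
split; under eq_fun do rewrite !mxE; [rewrite cReD cReN|rewrite cImD cImN].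
  by under eq_fun do rewrite cReD cReN; apply: cvgB => //; exact: cvg_cst.
by under eq_fun do rewrite cImD cImN; apply: cvgB => //; exact: cvg_cst.
Qed.

(** Lower semicontinuity of the norm under almost everywhere convergence. *)
Lemma L2_fatou n (f : nat -> vfun R n) (g : vfun R n) (c : R) :
  (forall k, L2 (f k)) -> vmeasurable g ->
  {ae arclength, forall z, cvg_coord (f ^~ z) (g z)} ->
  (forall k, sqnorm (f k) <= c) -> L2 g /\ sqnorm g <= c.
Proof.
move=> Lf mg fg fc.
have le_c : (\int[arclength]_z (nsq (g z))%:E <= c%:E)%E.
  apply: (@fatou_ae_bound _ _ _ (fun k z => nsq (f k z))) => //.
  - by move=> k; exact/measurable_nsq/L2_measurable.
  - by move=> k z; exact: nsq_ge0.
  - exact: measurable_nsq.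
  - by move=> z; exact: nsq_ge0.
  - by apply: filterS fg => z; exact: cvg_nsq.
  - by move=> k; rewrite -sqnormE// lee_fin.
have Lg : L2 g by split=> //; apply: (le_lt_trans le_c); rewrite ltry.
by split=> //; rewrite -lee_fin sqnormE.
Qed.

(** The real and imaginary parts of each entry inherit the geometric bound from
    the vector norm, so each converges to a measurable limit. *)
Lemma L2_cauchy_ae_cvg n (h : nat -> vfun R n) (C : R) :
  (forall k, L2 (h k)) -> (forall k, sqnorm (h k.+1 - h k) <= C * 4 ^- k) ->
  exists2 g : vfun R n, vmeasurable g &
    {ae arclength, forall z, cvg_coord (h ^~ z) (g z)}.
Proof.
move=> Lh hC.
have part (P : R[i] -> R) : (forall x y, P x - P y = P (x - y)) ->
    (forall x, P x ^+ 2 <= Re (`|x| ^+ 2)) ->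
    (forall k i, measurable_fun setT (fun z => P (h k z i 0))) ->
    forall i, exists v : circle R -> R, measurable_fun setT v /\
      {ae arclength, forall z, (fun k => P (h k z i 0)) @ \oo --> v z}.
  move=> PB Psq mP i.
  have [k|v mv cv] := @ae_cvg_of_geometric _ _ arclength
    (fun k z => P (h k z i 0)) C (mP ^~ i); last by exists v.
  have LB := L2B (Lh k.+1) (Lh k).
  rewrite (le_trans _ (_ : ((sqnorm (h k.+1 - h k))%:E <= _)%E)) ?lee_fin//.
  rewrite sqnormE//.
  apply: ge0_le_integral => //.
  - by move=> z _; rewrite lee_fin sqr_ge0.
  - by apply/measurable_EFinP; apply: measurable_funX; exact: measurable_funB.
  - by apply/measurable_EFinP/measurable_nsq/L2_measurable.
  - move=> z _; rewrite lee_fin PB (le_trans (Psq _))//.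
    by have := nsq_coord (h k.+1 z - h k z) i; rewrite !mxE.
have [||| v hv] := choice (part (@complex.Re R) _ _ _).
  - by move=> x y; rewrite cReD cReN.
  - by move=> x; rewrite Re_sqr_norm lerDl sqr_ge0.
  - by move=> k i; exact: ((Lh k).1 i).1.
have [||| w hw] := choice (part (@complex.Im R) _ _ _).
  - by move=> x y; rewrite cImD cImN.
  - by move=> x; rewrite Re_sqr_norm lerDr sqr_ge0.
  - by move=> k i; exact: ((Lh k).1 i).2.
exists (fun z => \col_i (v i z +i* w i z)).
  by move=> i; split; under eq_fun do rewrite mxE;
    [exact: (hv i).1|exact: (hw i).1].
have vw i : {ae arclength, forall z,
    (fun k => Re (h k z i 0)) @ \oo --> v i z /\
    (fun k => Im (h k z i 0)) @ \oo --> w i z}.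
  exact: filterS2 (hv i).2 (hw i).2.
by apply: filterS (filter_forall _ vw) => z vwz i; rewrite mxE; exact: vwz.
Qed.

End Completeness.

(** * The Hardy space and its orthogonal projection *)

Section Projection.
Variables (R : realType) (n : nat).
Implicit Types f g h : vfun R n.

(** The vector-valued exponentials z^m c, which detect the m-th Fourier
    coefficient. *)
Definition expo (m : int) (c : 'cV[R[i]]_n) : vfun R n :=
  fun z => (val z ^ m) *: c.

Lemma L2_expo m c : L2 (expo m c).
Proof.
apply: (@L2_dom _ _ _ (cst (nsq c))).
- move=> i; under eq_fun do rewrite mxE.
  by apply: cmeasurableM; [exact: cmeasurable_coordX|exact: cmeasurable_cst].
- exact: (@finite_measure_integrable_cst _ _ _ arclength).
- by apply: aeW => z; rewrite nsqZ normX_coord expr1n mul1r.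
Qed.

Lemma inner_expo f m c : L2 f -> inner f (expo m c) = dot (fourier f m) c.
Proof.
move=> Lf.
have ci i : cint (fun z => f z i 0 * val z ^ (- m)).
  have := cint_dot Lf (L2_expo m (delta_mx i 0)).
  congr cint; apply/funext => z; rewrite /dot (bigD1 i)//= big1 ?addr0.
    by rewrite !mxE !eqxx mulr1 conj_coordX.
  by move=> j ji; rewrite !mxE (negPf ji) andFb mulr0 conjC0 mulr0.
rewrite -[LHS]/(cintegral (fun z => dot (f z) (expo m c z))).
transitivity (cintegral (fun z => \sum_i (c i 0)^* * (f z i 0 * val z ^ (- m)))).
  congr cintegral; apply/funext => z; apply: eq_bigr => i _.
  by rewrite mxE rmorphM/= conj_coordX mulrA mulrC.
rewrite (@cintegral_sum R 'I_n _
  (fun i z => (c i 0)^* * (f z i 0 * val z ^ (- m)))).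
  by apply: eq_bigr => i _; rewrite cintegralZ// mulrC mxE.
by move=> i; exact: cintZ.
Qed.

(** The Hardy space is the orthogonal complement of the exponentials of negative
    frequency.  For the converse, the m-th Fourier coefficient of [f] is tested
    against the exponential with that very coefficient. *)
Lemma hardyP f : hardy f <->
  L2 f /\ forall m c, m < 0 -> inner f (expo m c) = 0.
Proof.
split=> [[Lf f0]|[Lf f0]]; split=> // m.
  move=> c m0; rewrite inner_expo// f0// /dot big1// => i _.
  by rewrite mxE mul0r.
move=> m0; apply: nsq_eq0; apply: (@complexI R).
by rewrite -dot_nsq -inner_expo// f0.
Qed.

Lemma hardy_L2 f : hardy f -> L2 f. Proof. by case. Qed.

Lemma hardy0 : hardy (0 : vfun R n).
Proof.
apply/hardyP; split=> [|m c _]; first exact: L2_0.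
by have := innerZl 0 (L2_expo m c) (L2_expo m c); rewrite scale0r mul0r.
Qed.

Lemma hardyD f g : hardy f -> hardy g -> hardy (f + g).
Proof.
move=> /hardyP[Lf f0] /hardyP[Lg g0]; apply/hardyP; split=> [|m c m0].
  exact: L2D.
by rewrite innerDl ?f0 ?g0 ?addr0//; exact: L2_expo.
Qed.

Lemma hardyZ a f : hardy f -> hardy (a *: f).
Proof.
move=> /hardyP[Lf f0]; apply/hardyP; split=> [|m c m0].
  exact: L2Z.
by rewrite innerZl ?f0 ?mulr0//; exact: L2_expo.
Qed.

Lemma hardyB f g : hardy f -> hardy g -> hardy (f - g).
Proof. by move=> ? ?; rewrite -scaleN1r; apply: hardyD => //; exact: hardyZ. Qed.

(** An orthogonal complement is closed, by the Cauchy-Schwarz inequality. *)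
Lemma hardy_closed g : L2 g ->
  (forall e, 0 < e -> exists2 h, hardy h & sqnorm (g - h) <= e) -> hardy g.
Proof.
move=> Lg gh; apply/hardyP; split=> // m c m0.
have Le := L2_expo m c; apply: Re_sqr_eq0; rewrite leNgt; apply/negP => B0.
set B := Re _ in B0; set Q := sqnorm (expo m c).
have Q0 : 0 <= Q := sqnorm_ge0 _.
(* With B > 0 the squared coefficient to be shown zero and Q the squared norm
   of the exponential, this tolerance makes B <= B Q / (2 (Q + 1)) absurd. *)
have [|h /hardyP[Lh h0] qh] := gh (B / (2 * (Q + 1))).
  by rewrite divr_gt0// mulr_gt0// ltr_wpDl.
have BQ : B <= sqnorm (g - h) * Q.
  rewrite /B -[inner g _](subr0) -(h0 _ c m0) -innerBl//.
  by apply: cauchy_schwarz => //; exact: L2B.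
have Q1 : 0 < 2 * (Q + 1) by rewrite mulr_gt0// ltr_wpDl.
have : B * (2 * (Q + 1)) <= B * Q.
  rewrite -ler_pdivlMr// mulrAC; apply: (le_trans BQ).
  by rewrite ler_wpM2r.
by rewrite ler_pM2l//; lra.
Qed.

Lemma cvg_coord_shift (u : nat -> 'cV[R[i]]_n) v k :
  cvg_coord u v -> cvg_coord (fun j => u (j + k)%N) v.
Proof.
move=> uv i; have [u1 u2] := uv i.
by split; [rewrite -(cvg_shiftn k) in u1|rewrite -(cvg_shiftn k) in u2].
Qed.

(** The Hilbert projection theorem.  A minimizing sequence [h] is chosen with
    squared distances within 4^-k of the infimum; the parallelogram law bounds
    the increments of [h] by a multiple of 4^-k, so [h] converges almost
    everywhere, and by Fatou's lemma its limit is a minimizer in the Hardy space. *)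
Lemma hardy_proj_exists f : L2 f ->
  exists g, hardy g /\ forall h, hardy h -> inner (f - g) h = 0.
Proof.
move=> Lf; pose D := [set sqnorm (f - h) | h in @hardy R n].
have D0 : D !=set0 by exists (sqnorm (f - 0)); exists 0 => //; exact: hardy0.
have Dlb : has_lbound D by exists 0 => _ [h _ <-]; exact: sqnorm_ge0.
pose d := inf D.
have dle h : hardy h -> d <= sqnorm (f - h).
  by move=> hh; apply: ge_inf => //; exists h.
have hk k : exists h, hardy h /\ sqnorm (f - h) <= d + 4 ^- k.
  have [|_ [h hh <-] hd] := @inf_adherent _ D (4 ^- k) _ (conj D0 Dlb).
    by rewrite invr_gt0 exprn_gt0.
  by exists h; split=> //; exact: ltW.
have [h hP] := choice hk.
have hh k : hardy (h k) := (hP k).1.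
have hd k : sqnorm (f - h k) <= d + 4 ^- k := (hP k).2.
have Lh k : L2 (h k) := hardy_L2 (hh k).
have LB k : L2 (f - h k) := L2B Lf (Lh k).
(* The parallelogram with sides f - h_k and f - h_l: half its long diagonal
   is the distance from f to the Hardy function (h_k + h_l) / 2, hence at
   least d. *)
have mid k l : sqnorm (h l - h k) <= 2 * (4 ^- k + 4 ^- l).
  have := parallelogram (LB k) (LB l).
  have -> : f - h k - (f - h l) = h l - h k by rewrite opprB addrC addrA subrK.
  have -> : f - h k + (f - h l) = 2 *: (f - 2^-1 *: (h k + h l)).
    rewrite scalerBr scalerA divff ?scale1r// scaler_nat mulr2n opprD.
    by rewrite addrACA.
  have hm : hardy (2^-1 *: (h k + h l)) by apply/hardyZ/hardyD.
  rewrite sqnormZ; last by apply: L2B => //; exact: hardy_L2.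
  have -> : Re (`|2 : R[i]| ^+ 2) = 4.
    have -> : 2 = (2 : R)%:C by rewrite rmorph_nat.
    by rewrite Re_sqr_norm -[Re _]/(2 : R) -[Im _]/(0 : R); ring.
  move: (dle _ hm) (hd k) (hd l).
  move: (sqnorm (f - _ *: _)) (sqnorm (f - h k)) (sqnorm (f - h l)).
  move: (sqnorm (h l - h k)).
  move=> a b c e *.
  lra.
have pow4 k j : (4 : R) ^- (j + k)%N <= 4 ^- k.
  rewrite lef_pV2 ?posrE ?exprn_gt0//.
  by rewrite ler_eXn2l ?leq_addl// ltr1n.
have [k|g mg hg] := @L2_cauchy_ae_cvg R n h 4 Lh.
  apply: (le_trans (mid k k.+1)).
  by have := pow4 k 1%N; rewrite add1n; lra.
(* Fatou's lemma along the tail starting at k. *)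
have fg k : L2 (f - g) /\ sqnorm (f - g) <= d + 4 ^- k.
  apply: (@L2_fatou _ _ (fun j => f - h (j + k)%N)) => //.
  - apply: vmeasurableD; first exact: L2_measurable.
    by rewrite -scaleN1r; exact: vmeasurableZ.
  - apply: filterS hg => z hgz.
    apply: (@cvg_coordBl _ _ (fun j => h (j + k)%N z)).
    exact: cvg_coord_shift hgz.
  - by move=> j; apply: (le_trans (hd _)); rewrite lerD2l.
have Lg : L2 g by rewrite -[g](subKr f); apply: L2B => //; exact: (fg 0%N).1.
have hg' k : sqnorm (g - h k) <= 4 * 4 ^- k.
  rewrite sqnormBC//; apply: (L2_fatou (f := fun j => h k - h (j + k)%N) _ _ _ _).2.
  - by move=> j; exact: L2B.
  - by apply: L2_measurable; exact: L2B.
  - apply: filterS hg => z hgz.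
    apply: (@cvg_coordBl _ _ (fun j => h (j + k)%N z)).
    exact: cvg_coord_shift hgz.
  - move=> j; apply: (le_trans (mid _ _)).
    by have := pow4 k j; lra.
have small e : 0 < e -> exists k, 4 * (4 : R) ^- k <= e.
  move=> e0; have := @cvg_geometric R 4 4^-1.
  rewrite ger0_norm ?invr_ge0// invf_lt1 ?ltr1n// => /(_ isT).
  move=> /cvgrPdist_le /(_ _ e0) [k _ /(_ k (leqnn _))].
  rewrite /= sub0r normrN exprVn => H; exists k.
  exact: le_trans (ler_norm _) H.
have hgH : hardy g.
  apply: hardy_closed => // e /small[k ke].
  by exists (h k) => //; exact: le_trans (hg' k) ke.
exists g; split=> // w hw.
apply: orthogonal_of_min; [exact: (fg 0%N).1|exact: hardy_L2|] => a.
apply: (@le_trans _ _ d).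
  rewrite leNgt; apply/negP => dlt.
  have [|k ke] := small ((sqnorm (f - g) - d)); first by rewrite subr_gt0.
  have := (fg k).2.
  have : 0 < (4 : R) ^- k by rewrite invr_gt0 exprn_gt0.
  by lra.
rewrite -addrA -opprD; apply: dle.
by apply: hardyD => //; exact: hardyZ.
Qed.

End Projection.

(** * Multiplication by bounded matrix symbols *)

Section Toeplitz.
Variable R : realType.

(** Far from optimal, but any constant depending only on the sizes and the bound
    on the entries will do. *)
Lemma nsq_mulmx_le m n (A : 'M[R[i]]_(m, n)) (u : 'cV[R[i]]_n) (M : R) :
  (forall i j, `|A i j| <= M%:C) ->
  nsq (A *m u) <= m%:R * (n%:R * M) ^+ 2 * nsq u.
Proof.
move=> AM; set s := Num.sqrt (nsq u).
have us j : `|u j 0| <= s%:C.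
  rewrite normc_def lecR ler_sqrt ?nsq_ge0//.
  by have := nsq_coord u j; rewrite Re_sqr_norm.
have sq : nsq u = s ^+ 2 by rewrite sqr_sqrtr// nsq_ge0.
rewrite sq -mulrA -exprMn -[m in m%:R]card_ord mulr_natl -sumr_const.
apply: ler_sum => i _.
have h : `|(A *m u) i 0| <= (n%:R * M * s)%:C.
  rewrite mxE (le_trans (ler_norm_sum _ _ _))//.
  have -> : (n%:R * M * s)%:C = \sum_(j < n) M%:C * s%:C.
    by rewrite sumr_const card_ord -[RHS]mulr_natl !rmorphM/= rmorph_nat mulrA.
  by apply: ler_sum => j _; rewrite normrM ler_pM.
have : `|(A *m u) i 0| ^+ 2 <= ((n%:R * M * s) ^+ 2)%:C.
  by rewrite rmorphXn/= lerXn2r// nnegrE// (le_trans _ h).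
by rewrite lecE => /andP[_].
Qed.

Lemma L2_mul m n (A : circle R -> 'M[R[i]]_(m, n)) (f : vfun R n) (M : R) :
  (forall i j, cmeasurable (fun z => A z i j)) ->
  {ae arclength, forall z, forall i j, `|A z i j| <= M%:C} -> L2 f ->
  L2 (fun z => A z *m f z) /\
  sqnorm (fun z => A z *m f z) <= m%:R * (n%:R * M) ^+ 2 * sqnorm f.
Proof.
move=> mA AM Lf; set C := _ * _ ^+ 2.
have C0 : 0 <= C by rewrite mulr_ge0// sqr_ge0.
have bd : {ae arclength, forall z, nsq (A z *m f z) <= C * nsq (f z)}.
  by apply: filterS AM => z; exact: nsq_mulmx_le.
have mAf : vmeasurable (fun z => A z *m f z).
  move=> i; under eq_fun do rewrite mxE.
  by apply: cmeasurable_sum => j; apply: cmeasurableM => //; exact: L2_measurable.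
have LA : L2 (fun z => A z *m f z).
  by apply: L2_dom bd => //; apply: rintZ; exact: L2_integrable.
split=> //; rewrite -lee_fin EFinM !sqnormE// -ge0_integralZl//; last 2 first.
- by apply/measurable_EFinP/measurable_nsq/L2_measurable.
- by move=> z _; rewrite lee_fin nsq_ge0.
apply: ae_ge0_le_integral => //.
- by move=> z _; rewrite lee_fin nsq_ge0.
- by apply/measurable_EFinP/measurable_nsq.
- by move=> z _; rewrite -EFinM lee_fin mulr_ge0 ?nsq_ge0.
- apply/measurable_EFinP; apply: measurable_funM => //.
  by apply/measurable_nsq/L2_measurable.
- by apply: filterS bd => z h _; rewrite -EFinM lee_fin.
Qed.

(** A constant matrix acting on values; rectangular, since rows will map
    C^n-valued functions to scalar ones. *)
Definition mxact m n (A : 'M[R[i]]_(m, n)) (f : vfun R n) : vfun R m :=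
  fun z => A *m f z.

Lemma inner_mul_adj m n (A : circle R -> 'M[R[i]]_(m, n)) (f : vfun R n)
    (g : vfun R m) :
  inner (fun z => A z *m f z) g = inner f (fun z => (A z)^t* *m g z).
Proof. by congr cintegral; apply/funext => z; exact: dot_adj. Qed.

Lemma L2_mxact m n (A : 'M[R[i]]_(m, n)) f : L2 f -> L2 (mxact A f).
Proof.
move=> Lf; pose M := \sum_i \sum_j Re `|A i j|.
have nE (x : R[i]) : `|x| = (Re `|x|)%:C by rewrite normc_def.
have n0 (x : R[i]) : 0 <= Re `|x| by rewrite -ler0c -nE.
apply: (L2_mul (A := fun=> A) (M := M) _ _ Lf).1.
  by move=> i j; exact: cmeasurable_cst.
apply: aeW => z i j; rewrite nE lecR /M (bigD1 i)// (bigD1 j)//=.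
by rewrite -addrA lerDl addr_ge0// sumr_ge0// => k _; rewrite sumr_ge0.
Qed.

(** The adjoint matrix sends exponentials to exponentials of the same frequency. *)
Lemma hardy_mxact m n (A : 'M[R[i]]_(m, n)) f : hardy f -> hardy (mxact A f).
Proof.
move=> /hardyP[Lf f0]; apply/hardyP; split=> [|k c k0]; first exact: L2_mxact.
rewrite (inner_mul_adj (fun=> A)) -(f0 k (A^t* *m c) k0).
by congr inner; apply/funext => z; rewrite /expo scalemxAr.
Qed.

(** * Pairs of mutually adjoint operators on the Hardy space *)

Section AdjointPair.
Variable n : nat.
Implicit Types (f g h : vfun R n) (T S : vfun R n -> vfun R n).

(** The difference is itself a Hardy function, so it is orthogonal to itself. *)
Lemma hardy_weak_eq f g : hardy f -> hardy g ->
  (forall h, hardy h -> inner f h = inner g h) -> ae_eq arclength setT f g.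
Proof.
move=> hf hg fg; have [Lf Lg] := (hardy_L2 hf, hardy_L2 hg).
apply/sqnorm_sub_eq0 => //; apply: (@complexI R).
have hB := hardyB hf hg.
by rewrite -inner_sqnorm innerBl ?fg ?subrr//; exact: hardy_L2.
Qed.

(** Linearity, compatibility with almost everywhere equality and uniqueness of
    the adjoint all follow from this symmetric relation, without reference to
    symbols. *)
Definition adjoint_pair T S :=
  [/\ forall f, hardy f -> hardy (T f), forall f, hardy f -> hardy (S f)
    & forall f g, hardy f -> hardy g -> inner (T f) g = inner f (S g)].

Lemma adjoint_pairC T S : adjoint_pair T S -> adjoint_pair S T.
Proof.
move=> [hT hS TS]; split=> // f g hf hg.
have [hSf hTg] := (hS f hf, hT g hg).
rewrite (innerC (hardy_L2 hg) (hardy_L2 hSf)) -(TS _ _ hg hf).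
by rewrite -(innerC (hardy_L2 hTg) (hardy_L2 hf)).
Qed.

Lemma adjoint_pair_ae T S f g : adjoint_pair T S -> hardy f -> hardy g ->
  ae_eq arclength setT f g -> ae_eq arclength setT (T f) (T g).
Proof.
move=> [hT hS TS] hf hg fg.
apply: (hardy_weak_eq (hT f hf) (hT g hg)) => h hh.
rewrite (TS f h hf hh) (TS g h hg hh).
exact: (inner_ae_eql (hardy_L2 hf) (hardy_L2 hg) (hardy_L2 (hS h hh)) fg).
Qed.

Lemma adjoint_pair_linear T S a f g : adjoint_pair T S -> hardy f -> hardy g ->
  ae_eq arclength setT (T (a *: f + g)) (a *: T f + T g).
Proof.
move=> [hT hS TS] hf hg.
have [haf haT] := (hardyZ a hf, hardyZ a (hT f hf)).
apply: (hardy_weak_eq (hT _ (hardyD haf hg)) (hardyD haT (hT g hg))) => h hh.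
have [Lf Lg Lh] := And3 (hardy_L2 hf) (hardy_L2 hg) (hardy_L2 hh).
have LS := hardy_L2 (hS h hh).
rewrite (TS _ h (hardyD haf hg) hh).
rewrite (innerDl (hardy_L2 haf) Lg LS) (innerZl a Lf LS).
rewrite (innerDl (hardy_L2 haT) (hardy_L2 (hT g hg)) Lh).
by rewrite (innerZl a (hardy_L2 (hT f hf)) Lh) (TS f h hf hh) (TS g h hg hh).
Qed.

(** Any partner in an adjoint pair computes the chosen adjoint. *)
Lemma adjoint_pairE T S g : adjoint_pair T S -> hardy g ->
  hardy (adjoint T g) /\ ae_eq arclength setT (adjoint T g) (S g).
Proof.
move=> TS hg; have [_ _ ST] := adjoint_pairC TS; have [hT hS TSE] := TS.
have ex : exists h, hardy h /\ forall f, hardy f -> inner (T f) g = inner f h.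
  by exists (S g); split; [exact: hS|move=> f hf; exact: TSE].
have [ha aE] := xgetPex (cst 0) ex.
split; first exact: ha.
apply: (hardy_weak_eq ha (hS g hg)) => h hh.
rewrite (innerC (hardy_L2 hh) (hardy_L2 ha)) -(aE h hh) (ST g h hg hh).
by rewrite -(innerC (hardy_L2 (hT h hh)) (hardy_L2 hg)).
Qed.

(** With [S] the adjoint of [T], this is the commutation of the two products ST
    and TS. *)
Definition commuting_products T S :=
  forall f, hardy f -> ae_eq arclength setT (S (T (T (S f)))) (T (S (S (T f)))).

(** Replacing the chosen adjoint by [S] inside a word changes it only on a null
    set, because each operator respects almost everywhere equality. *)
Lemma adjoint_pair_binormalP T S : adjoint_pair T S -> bounded_op T ->
  binormal T <-> commuting_products T S.
Proof.
move=> TS bT; have [hT hS _] := TS.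
have cT f g : hardy f -> hardy g -> ae_eq arclength setT f g ->
  ae_eq arclength setT (T f) (T g) by exact: adjoint_pair_ae TS.
have cS f g : hardy f -> hardy g -> ae_eq arclength setT f g ->
  ae_eq arclength setT (S f) (S g) by exact: adjoint_pair_ae (adjoint_pairC TS).
have hA f : hardy f -> hardy (adjoint T f) by move=> /(adjoint_pairE TS)[].
have eA f : hardy f -> ae_eq arclength setT (adjoint T f) (S f).
  by move=> /(adjoint_pairE TS)[].
have E1 f : hardy f ->
    ae_eq arclength setT (adjoint T (T (T (adjoint T f)))) (S (T (T (S f)))).
  move=> hf; have [hAf hSf] := (hA f hf, hS f hf).
  have [hTA hTS] := (hT _ hAf, hT _ hSf).
  apply: ae_eq_trans (eA _ (hT _ hTA)) _.
  apply: (cS _ _ (hT _ hTA) (hT _ hTS)).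
  by apply: (cT _ _ hTA hTS); apply: (cT _ _ hAf hSf); exact: eA.
have E2 f : hardy f ->
    ae_eq arclength setT (T (adjoint T (adjoint T (T f)))) (T (S (S (T f)))).
  move=> /hT hTf; have [hAT hST] := (hA _ hTf, hS _ hTf).
  apply: (cT _ _ (hA _ hAT) (hS _ hST)).
  apply: ae_eq_trans (eA _ hAT) _.
  by apply: (cS _ _ hAT hST); exact: eA.
split=> [[_ c] f hf|c].
  exact: ae_eq_trans (ae_eq_trans (ae_eq_sym (E1 f hf)) (c f hf)) (E2 f hf).
split; first exact: bT.
move=> f hf.
exact: ae_eq_trans (ae_eq_trans (E1 f hf) (c f hf)) (ae_eq_sym (E2 f hf)).
Qed.

End AdjointPair.

(** * Toeplitz operators *)

Section SquareSymbol.
Variable n : nat.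
Implicit Types (f g h F : vfun R n) (Phi : mxfun R n).

Lemma hardy_projP F : L2 F ->
  hardy (hardy_proj F) /\ forall h, hardy h -> inner (F - hardy_proj F) h = 0.
Proof. by move=> LF; apply: (xgetPex (cst 0) (hardy_proj_exists LF)). Qed.

Lemma L2_symbol Phi f : Linfty Phi -> L2 f -> L2 (fun z => Phi z *m f z).
Proof. by move=> [mP [M PM]] Lf; exact: (L2_mul mP PM Lf).1. Qed.

Lemma Linfty_adj Phi : Linfty Phi -> Linfty (fun z => (Phi z)^t*).
Proof.
move=> [mP [M PM]]; split=> [i j|].
  by under eq_fun do rewrite !mxE; exact: cmeasurableC.
exists M; apply: filterS PM => z PM i j.
by rewrite !mxE norm_conjC.
Qed.

Lemma toeplitz_hardy Phi f : Linfty Phi -> hardy f -> hardy (toeplitz Phi f).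
Proof. by move=> LP /hardy_L2 Lf; apply: (hardy_projP _).1; exact: L2_symbol. Qed.

(** Against Hardy functions the projection in a Toeplitz operator is invisible. *)
Lemma inner_toeplitz Phi f h : Linfty Phi -> hardy f -> hardy h ->
  inner (toeplitz Phi f) h = inner (fun z => Phi z *m f z) h.
Proof.
move=> LP hf hh; have LF := L2_symbol LP (hardy_L2 hf).
have [hT /(_ h hh)] := hardy_projP LF.
by rewrite innerBl//; [move=> /subr0_eq|exact: hardy_L2..].
Qed.

(** Both inner products equal the one of the products with the symbol, by
    [inner_toeplitz] on either side. *)
Lemma toeplitz_adjoint_pair Phi : Linfty Phi ->
  adjoint_pair (toeplitz Phi) (toeplitz (fun z => (Phi z)^t*)).
Proof.
move=> LP; have LA := Linfty_adj LP.
split=> [f|f|f g hf hg]; [exact: toeplitz_hardy|exact: toeplitz_hardy|].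
have [Lf Lg] := (hardy_L2 hf, hardy_L2 hg).
have LAg := L2_symbol LA Lg; have hS := toeplitz_hardy LA hg.
rewrite (inner_toeplitz LP hf hg) inner_mul_adj (innerC LAg Lf).
by rewrite -(inner_toeplitz LA hg hf) -(innerC (hardy_L2 hS) Lf).
Qed.

Lemma norm2E f : norm2 f = Num.sqrt (sqnorm f).
Proof. by rewrite /norm2 inner_sqnorm. Qed.

(** A projection does not increase the norm, as the Cauchy-Schwarz inequality
    applied to Phi f and its projection shows. *)
Lemma toeplitz_bounded Phi : Linfty Phi -> bounded_op (toeplitz Phi).
Proof.
move=> LP; split; first by move=> f; exact: toeplitz_hardy.
  by move=> a f g; exact: adjoint_pair_linear (toeplitz_adjoint_pair LP).
have [mP [M PM]] := LP.
exists (Num.sqrt (n%:R * (n%:R * M) ^+ 2)) => f hf.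
have [LF qF] := L2_mul mP PM (hardy_L2 hf).
have hT := toeplitz_hardy LP hf.
have C0 : 0 <= n%:R * (n%:R * M) ^+ 2 by rewrite mulr_ge0// sqr_ge0.
rewrite !norm2E -sqrtrM// ler_sqrt; last by rewrite mulr_ge0// sqnorm_ge0.
apply: le_trans qF.
have := cauchy_schwarz LF (hardy_L2 hT);
rewrite -(inner_toeplitz LP hf hT) inner_sqnorm.
have -> : Re (`|(sqnorm (toeplitz Phi f))%:C| ^+ 2) = sqnorm (toeplitz Phi f) ^+ 2.
  by rewrite Re_sqr_norm -[Re _]/(sqnorm _) -[Im _]/(0 : R); ring.
have := sqnorm_ge0 (toeplitz Phi f); rewrite le_eqVlt => /orP[/eqP <- _|q0].
  exact: sqnorm_ge0.
by rewrite expr2 ler_pM2r.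
Qed.

End SquareSymbol.

End Toeplitz.

(** * Operators intertwined by a constant matrix *)

Section Intertwining.
Variable R : realType.

Lemma mxact_ae m n (A : 'M[R[i]]_(m, n)) (f g : vfun R n) :
  ae_eq arclength setT f g -> ae_eq arclength setT (mxact A f) (mxact A g).
Proof. by apply: filterS => z fg /fg; rewrite /mxact => ->. Qed.

Definition intertwines m n (A : 'M[R[i]]_(m, n))
    (T : vfun R n -> vfun R n) (T' : vfun R m -> vfun R m) :=
  forall f, hardy f -> ae_eq arclength setT (mxact A (T f)) (T' (mxact A f)).

(** Tested against a Hardy function [h], the matrix moves to [A^t* h], which is
    again a Hardy function, so that the projection can be dropped and restored. *)
Lemma toeplitz_intertwines m n (A : 'M[R[i]]_(m, n)) (Phi : mxfun R n)
    (Psi : mxfun R m) : Linfty Phi -> Linfty Psi ->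
  (forall z, A *m Phi z = Psi z *m A) ->
  intertwines A (toeplitz Phi) (toeplitz Psi).
Proof.
move=> LP LQ AP f hf; have hAf := hardy_mxact A hf.
apply: (hardy_weak_eq (hardy_mxact A (toeplitz_hardy LP hf))
  (toeplitz_hardy LQ hAf)).
move=> h hh; apply: esym; have hAh := hardy_mxact (A^t*) hh.
apply: (etrans (inner_toeplitz LQ hAf hh)).
transitivity (inner (mxact A (fun z => Phi z *m f z)) h).
  by congr inner; apply/funext => z; rewrite /mxact !mulmxA AP.
apply: (etrans (inner_mul_adj (fun=> A) _ _)).
apply: (etrans (esym (inner_toeplitz LP hf hAh))).
exact: esym (inner_mul_adj (fun=> A) _ _).
Qed.

(** The matrix is moved inward past one operator at a time; each step is an
    equality almost everywhere inside the remaining operators, which respect it. *)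
Lemma intertwines_STTS m n (A : 'M[R[i]]_(m, n)) T S T' S' f :
  adjoint_pair T S -> adjoint_pair T' S' ->
  intertwines A T T' -> intertwines A S S' -> hardy f ->
  ae_eq arclength setT (mxact A (S (T (T (S f)))))
    (S' (T' (T' (S' (mxact A f))))).
Proof.
move=> TS TS' AT AS hf; have [hT hS _] := TS; have [hT' hS' _] := TS'.
have hA g : hardy g -> hardy (mxact A g) by exact: hardy_mxact.
have h1 := hS f hf; have h2 := hT _ h1; have h3 := hT _ h2.
have k1 := hS' _ (hA f hf); have k2 := hT' _ k1; have k3 := hT' _ k2.
apply: ae_eq_trans (AS _ h3) _.
apply: (adjoint_pair_ae (adjoint_pairC TS') (hA _ h3) k3).
apply: ae_eq_trans (AT _ h2) _.
apply: (adjoint_pair_ae TS' (hA _ h2) k2).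
apply: ae_eq_trans (AT _ h1) _.
apply: (adjoint_pair_ae TS' (hA _ h1) k1).
exact: AS hf.
Qed.

Section Transport.
Variables (m n : nat) (A : 'M[R[i]]_(m, n)).
Variables (T S : vfun R n -> vfun R n) (T' S' : vfun R m -> vfun R m).
Hypotheses (TS : adjoint_pair T S) (TS' : adjoint_pair T' S').
Hypotheses (AT : intertwines A T T') (AS : intertwines A S S').

(** A coisometry is onto, so the identity passes to the target. *)
Lemma commuting_products_coisometry : A *m A^t* = 1%:M ->
  commuting_products T S -> commuting_products T' S'.
Proof.
move=> AA c g hg; have hB := hardy_mxact (A^t*) hg.
have gE : g = mxact A (mxact (A^t*) g).
  by apply/funext => z; rewrite /mxact mulmxA AA mul1mx.
have h1 := intertwines_STTS TS TS' AT AS hB.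
have h2 := intertwines_STTS (adjoint_pairC TS) (adjoint_pairC TS') AS AT hB.
rewrite -gE in h1 h2.
exact: ae_eq_trans (ae_eq_trans (ae_eq_sym h1) (mxact_ae A (c _ hB))) h2.
Qed.

Lemma commuting_products_pullback : commuting_products T' S' -> forall f, hardy f ->
  ae_eq arclength setT (mxact A (S (T (T (S f))))) (mxact A (T (S (S (T f))))).
Proof.
move=> c f hf.
have h1 := intertwines_STTS TS TS' AT AS hf.
have h2 := intertwines_STTS (adjoint_pairC TS) (adjoint_pairC TS') AS AT hf.
exact: ae_eq_trans (ae_eq_trans h1 (c _ (hardy_mxact A hf))) (ae_eq_sym h2).
Qed.

End Transport.

End Intertwining.

(** * Roots of unity and the Fourier matrix *)

Section Fourier.
Variable R : realType.

Lemma expiD (s t : R) : expi (s + t) = expi s * expi t.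
Proof.
apply: complex_ext; rewrite ?cReM ?cImM /expi /complex.Re /complex.Im ?cosD ?sinD;
  ring.
Qed.

Lemma expiMn (t : R) k : expi t ^+ k = expi (k%:R * t).
Proof.
elim: k => [|k IH]; first by rewrite mul0r /expi cos0 sin0.
by rewrite exprSr IH -expiD -natr1 mulrDl mul1r.
Qed.

Variables (n : nat) (n_ge1 : (1 <= n)%N).
Notation mu := (mu_root R n).

Lemma mu_unity : mu ^+ n = 1.
Proof.
rewrite expiMn mulrC divfK ?pnatr_eq0 -?lt0n// /expi.
by rewrite mulr_natl cos2pi sin2pi.
Qed.

Lemma mu_conj k : (mu ^+ k)^* = mu ^- k.
Proof.
have /eqP m1 := norm_expi (2 * pi / n%:R : R).
rewrite rmorphXn /= -exprVn; congr (_ ^+ _).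
by rewrite invC_norm m1 expr1n invr1 mul1r.
Qed.

Lemma mu_neq0 : mu != 0.
Proof. by rewrite -normr_gt0 (eqP (norm_expi _)). Qed.

(** If mu^k = 1 then the cosine of twice pi k / n is 1, so its sine vanishes,
    though pi k / n lies strictly between 0 and pi. *)
Lemma mu_primitive k : (0 < k < n)%N -> mu ^+ k != 1.
Proof.
move=> /andP[k0 kn]; apply/eqP; rewrite expiMn => /(congr1 (@complex.Re R)).
set t : R := pi * k%:R / n%:R.
have -> : k%:R * (2 * pi / n%:R) = t + t by rewrite /t; ring.
rewrite /expi /complex.Re cosD -[X in X - _]expr2 cos2sin2 -expr2 => h.
have {}h : 1 - sin t ^+ 2 - sin t ^+ 2 = 1 := h.
have : 0 < sin t.
  have n0 : (0 : R) < n%:R by rewrite ltr0n.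
  apply: sin_gt0_pi; rewrite /t divr_gt0 ?mulr_gt0 ?pi_gt0 ?ltr0n//=.
  by rewrite ltr_pdivrMr// ltr_pM2l ?pi_gt0// ltr_nat.
by move=> s0; have := exprn_gt0 2 s0; lra.
Qed.

Lemma mu_inj i j : (i < n)%N -> (j < n)%N -> mu ^+ i = mu ^+ j -> i = j.
Proof.
wlog ij : i j / (i <= j)%N.
  by move=> W ni nj e; case/orP: (leq_total i j) => h; [|apply/esym]; exact: W.
move=> _ nj e; apply/eqP; rewrite eqn_leq ij leqNgt; apply/negP => ltij.
have := @mu_primitive (j - i).
rewrite subn_gt0 ltij (leq_ltn_trans (leq_subr _ _) nj) => /(_ isT)/eqP[].
apply: (mulfI (expf_neq0 i mu_neq0)).
by rewrite -exprD subnKC// e mulr1.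
Qed.

(** Orthogonality of the characters of the cyclic group, by summing a geometric
    progression. *)
Lemma mu_sum (i j : 'I_n) :
  \sum_(k < n) mu ^+ (i * k) * (mu ^+ (j * k))^* = (if i == j then n%:R else 0).
Proof.
have term k : mu ^+ (i * k) * (mu ^+ (j * k))^* = (mu ^+ i / mu ^+ j) ^+ k.
  by rewrite mu_conj exprMn exprVn -!exprM.
under eq_bigr do rewrite term.
have [->|ij] := eqVneq.
  under eq_bigr do rewrite divff ?expf_neq0 ?mu_neq0// expr1n.
  by rewrite sumr_const card_ord.
have /eqP : (mu ^+ i / mu ^+ j - 1) * \sum_(k < n) (mu ^+ i / mu ^+ j) ^+ k = 0.
  rewrite -subrX1 exprMn exprVn -!exprM ![(_ * n)%N]mulnC !exprM mu_unity.
  by rewrite !expr1n divff ?oner_eq0// subrr.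
rewrite mulf_eq0 subr_eq0 => /orP[/eqP h|/eqP//].
case/negP: ij; apply/eqP/val_inj; apply: mu_inj (ltn_ord i) (ltn_ord j) _.
by rewrite -[LHS](divfK (expf_neq0 j mu_neq0)) h mul1r.
Qed.

Lemma dft_unitary : dft_mx R n \is unitarymx.
Proof.
apply/unitarymxP/matrixP => i j; rewrite !mxE.
have n0 : (0 : R) < n%:R by rewrite ltr0n.
have cC : ((Num.sqrt n%:R)^-1%:C : R[i])^* = (Num.sqrt n%:R)^-1%:C.
  by rewrite conj_Creal//; apply/complex_realP; eexists.
transitivity ((n%:R^-1 : R[i]) * \sum_(k < n) mu ^+ (i * k) * (mu ^+ (j * k))^*).
  rewrite mulr_sumr; apply: eq_bigr => k _; rewrite !mxE rmorphM/= cC.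
  rewrite mulrACA; congr (_ * _).
  rewrite -rmorphM/= -expr2 exprVn sqr_sqrtr ?ltW// fmorphV/= rmorph_nat.
  by [].
rewrite mu_sum; case: eqP => _; rewrite ?mulr0// mulVf// pnatr_eq0 -lt0n//.
Qed.

(** Shifting an index back by one divides its power of mu by mu: the wrap-around
    at 0 is harmless as mu^n = 1. *)
Lemma mu_ord_pred i (j : 'I_n) :
  mu ^+ (iter i (@ord_pred n) j) * mu ^+ i = mu ^+ j.
Proof.
elim: i => [|i IH]; first by rewrite mulr1.
rewrite -IH iterS exprS mulrA; congr (_ * _).
set l := iter _ _ _; rewrite /= expr_mod ?mu_unity// -exprSr prednK.
  by rewrite exprD mu_unity mulr1.
by rewrite addn_gt0 n_ge1 orbT.
Qed.

(** The Fourier vectors are eigenvectors of every circulant matrix; row i is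
    reindexed by its shift. *)
Lemma circ_dft (a : 'I_n -> R[i]) :
  circ a *m dft_mx R n =
  dft_mx R n *m diag_mx (\row_k \sum_(j < n) a j * mu ^+ (j * k)).
Proof.
apply/matrixP => i k; rewrite mul_mx_diag !mxE mulr_sumr.
have inj : injective (iter i (@ord_pred n)).
  by elim: (nat_of_ord i) => [|l IH] x y //= /(can_inj (@ord_predK n))/IH.
rewrite [RHS](reindex_inj inj); apply: eq_bigr => j _; rewrite !mxE.
have -> : mu ^+ (j * k) = mu ^+ (iter i (@ord_pred n) j * k) * mu ^+ (i * k).
  by rewrite !exprM -exprMn mu_ord_pred.
ring.
Qed.

Lemma dft_diag (a : 'I_n -> R[i]) :
  (dft_mx R n)^t* *m circ a *m dft_mx R n =
  diag_mx (\row_k \sum_(j < n) a j * mu ^+ (j * k)).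
Proof.
by rewrite -mulmxA circ_dft mulmxA (mulmx1C (unitarymxP dft_unitary)) mul1mx.
Qed.

End Fourier.

(** * Rows of the adjoint Fourier matrix intertwine the symbols *)

Section Symbols.
Variables (R : realType) (n : nat) (phi : 'I_n -> circle R -> R[i]).
Hypotheses (n_ge1 : (1 <= n)%N) (LPhi : Linfty (circ_fun phi)).
Notation U := (dft_mx R n).

(** Every phi_j occurs as an entry of the first row of the circulant symbol, and
    lambda_k is a combination of them with unimodular coefficients. *)
Lemma Linfty_eigenfun k : Linfty (fun z => (eigenfun phi k z)%:M : 'M[R[i]]_1).
Proof.
have [mP [M PM]] := LPhi; pose i0 := Ordinal n_ge1.
have phiE j z : circ_fun phi z i0 j = phi j z by rewrite /circ_fun mxE.
have mphi j : cmeasurable (phi j).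
  by have := mP i0 j; congr cmeasurable; apply/funext => z; rewrite phiE.
split=> [i j|].
  rewrite !ord1; under eq_fun do rewrite mxE eqxx mulr1n.
  apply: cmeasurable_sum => l; apply: cmeasurableM; first exact: mphi.
  exact: (@cmeasurable_cst R).
exists (n%:R * M); apply: filterS PM => z PM i j.
rewrite !ord1 mxE eqxx mulr1n (le_trans (ler_norm_sum _ _ _))//.
rewrite [leRHS](_ : _ = \sum_(l < n) M%:C); last first.
  by rewrite sumr_const card_ord -[RHS]mulr_natl rmorphM/= rmorph_nat.
apply: ler_sum => l _; rewrite normrM normrX (eqP (norm_expi _)) expr1n mulr1.
by rewrite -phiE.
Qed.

Lemma row_dft_eigen k z :
  row k (U^t*) *m circ_fun phi z = (eigenfun phi k z)%:M *m row k (U^t*).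
Proof.
have UU := unitarymxP (dft_unitary R n_ge1).
have E : U^t* *m circ_fun phi z =
    diag_mx (\row_l eigenfun phi l z) *m U^t*.
  by rewrite -[LHS]mulmx1 -UU mulmxA (dft_diag n_ge1 (fun j => phi j z)).
by rewrite -row_mul E; apply/rowP => j; rewrite mul_diag_mx mul_scalar_mx !mxE.
Qed.

Lemma row_dft_eigen_adj k z :
  row k (U^t*) *m (circ_fun phi z)^t* = ((eigenfun phi k z)%:M)^t* *m row k (U^t*).
Proof.
have UU := unitarymxP (dft_unitary R n_ge1).
have E : U^t* *m (circ_fun phi z)^t* =
    (diag_mx (\row_l eigenfun phi l z))^t* *m U^t*.
  have /(congr1 (fun M => M^t*)) := dft_diag n_ge1 (fun j => phi j z).
  rewrite !trmx_mul !map_mxM /= trmxCK mulmxA => D.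
  by rewrite -[LHS]mulmx1 -UU mulmxA D.
rewrite -row_mul E tr_diag_mx map_diag_mx tr_scalar_mx map_scalar_mx.
by apply/rowP => j; rewrite mul_diag_mx mul_scalar_mx !mxE.
Qed.

Lemma row_dft_coisometry k : row k (U^t*) *m (row k (U^t*))^t* = 1%:M.
Proof.
have UU := mulmx1C (unitarymxP (dft_unitary R n_ge1)).
apply/matrixP => i j; rewrite !ord1.
have := congr1 (fun M : 'M[R[i]]_n => M k k) UU.
rewrite !mxE eqxx => <-.
by apply: eq_bigr => l _; rewrite !mxE conjCK.
Qed.

End Symbols.

Theorem corollary3p8 (R : realType) (n : nat) (n_ge1 : (1 <= n)%N)
    (phi : 'I_n -> circle R -> R[i]) (Phi_Linfty : Linfty (circ_fun phi)) :
  [/\ dft_mx R n \is unitarymx,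
      forall z, (dft_mx R n)^t* *m circ_fun phi z *m dft_mx R n =
                diag_mx (\row_k eigenfun phi k z)
    & binormal (toeplitz (circ_fun phi)) <->
      forall k : 'I_n, binormal (scalar_toeplitz (eigenfun phi k))].
Proof.
split; [exact: dft_unitary|by move=> z; exact: dft_diag|].
pose w k := row k ((dft_mx R n)^t*).
have L := Phi_Linfty; have Lk := Linfty_eigenfun n_ge1 L.
have TS := toeplitz_adjoint_pair L.
have TSk k := toeplitz_adjoint_pair (Lk k).
have wT k := toeplitz_intertwines L (Lk k) (row_dft_eigen phi n_ge1 k).
have wS k := toeplitz_intertwines (Linfty_adj L) (Linfty_adj (Lk k))
  (row_dft_eigen_adj phi n_ge1 k).
have B := adjoint_pair_binormalP TS (toeplitz_bounded L).
have Bk k := adjoint_pair_binormalP (TSk k) (toeplitz_bounded (Lk k)).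
split=> [/B c k|ck].
  apply/Bk.
  exact: (commuting_products_coisometry TS (TSk k) (wT k) (wS k)
    (row_dft_coisometry R n_ge1 k) c).
apply/B => f hf.
set D := (X in ae_eq _ _ X _); set E := (X in ae_eq _ _ _ X).
have wc k : {ae arclength, forall z, setT z -> mxact (w k) D z = mxact (w k) E z}.
  exact: (commuting_products_pullback TS (TSk k) (wT k) (wS k)
    ((Bk k).1 (ck k)) hf).
clearbody D E.
apply: filterS (filter_forall _ wc) => z wz _.
have UU := unitarymxP (dft_unitary R n_ge1).
have Uinj (x y : 'cV[R[i]]_n) :
    (dft_mx R n)^t* *m x = (dft_mx R n)^t* *m y -> x = y.
  by move=> /(congr1 (mulmx (dft_mx R n))); rewrite !mulmxA UU !mul1mx.
by apply: Uinj; apply/row_matrixP => k; rewrite !row_mul; exact: wz k I.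
Qed.
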